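(* Let $(V,\mu)$ be a simple, strongly connected, finite weighted directed graph. For $K\in\mathbb{R}$, the following are equivalent: (1) $\inf_{x\neq y}\kappa(x,y)\geq K$, the infimum being over all $x,y\in V$ with $x\ne y$; (2) for all $f:V\to\mathbb{R}$ and all $t>0$, $\mathrm{Lip}(P_t f)\leq e^{-Kt}\,\mathrm{Lip} f$; (3) for all $x,y\in V$ and all $t>0$, $W(p^{t}_{x},p^{t}_{y})\leq e^{-Kt}d(x,y)$.
   Context: A finite weighted directed graph $(V,\mu)$ is a finite set $V$ with an edge weight $\mu:V\times V\to[0,\infty)$, $\mu_{xy}:=\mu(x,y)$ (not necessarily symmetric); write $x\to y$ iff $\mu_{xy}>0$. It is simple if $\mu_{xx}=0$ for all $x$, and strongly connected if for any $x,y\in V$ there is a directed path $x=x_0\to x_1\to\dots\to x_l=y$. The (non-symmetric) distance $d(x,y)$ is the minimal length $l$ of a directed path from $x$ to $y$. Gradient and Lipschitz constant: for $x\neq y$ and $f:V\to\mathbb{R}$, $\nabla_{xy}f:=\frac{f(y)-f(x)}{d(x,y)}$ and $\mathrm{Lip} f:=\sup_{x\neq y}\nabla_{xy}f$. Transition kernels: $P(x,y):=\mu_{xy}/\mu(x)$ with $\mu(x):=\sum_{y\in V}\mu_{xy}>0$. The Perron measure $\mathfrak{m}:V\to(0,1]$ is the unique probability measure with $\mathfrak{m}(x)=\sum_{y\in V}\mathfrak{m}(y)P(y,x)$. Put $\overleftarrow{P}(x,y):=\frac{\mathfrak{m}(y)}{\mathfrak{m}(x)}P(y,x)$ and $\mathcal{P}:=\frac12(P+\overleftarrow{P})$.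 Chung Laplacian: $\mathcal{L}f(x):=f(x)-\sum_{y\in V}\mathcal{P}(x,y)f(y)$. Heat semigroup: $P_t:=e^{-t\mathcal{L}}$. Heat kernel measure: $p^t_x(y):=\frac{\mathfrak{m}(y)}{\mathfrak{m}(x)}(P_t\delta_x)(y)$, where $\delta_x(z)=1$ if $z=x$ and $0$ otherwise; it is a probability measure on $V$. Wasserstein distance: for probability measures $\nu_0,\nu_1$ on $V$, $W(\nu_0,\nu_1):=\inf_{\pi}\sum_{x,y\in V}d(x,y)\pi(x,y)$, the infimum being over all couplings, i.e. probability measures $\pi$ on $V\times V$ with $\sum_y\pi(x,y)=\nu_0(x)$ and $\sum_x\pi(x,y)=\nu_1(y)$. Ricci curvature: for $\epsilon\in[0,1]$ let $\nu^\epsilon_x(z):=(1-\epsilon)\delta_x(z)+\epsilon\,\mathcal{P}(x,z)$; for $x\ne y$ let $\kappa_\epsilon(x,y):=1-\frac{W(\nu^\epsilon_x,\nu^\epsilon_y)}{d(x,y)}$ and $\kappa(x,y):=\lim_{\epsilon\to0^+}\kappa_\epsilon(x,y)/\epsilon$ (this limit is known to exist). *)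

(* Defs.v *)
From mathcomp Require Import all_boot all_order all_algebra.
From mathcomp Require Import all_classical all_reals all_analysis.
Set Implicit Arguments.
Unset Strict Implicit.
Unset Printing Implicit Defensive.
Import Order.TTheory GRing.Theory Num.Theory.
Import numFieldNormedType.Exports.
Local Open Scope classical_set_scope.
Local Open Scope ring_scope.

(* A finite weighted directed graph is a finite type of vertices V together   *)
(* with an edge weight mu : V -> V -> R.                                      *)

Definition nonneg_weight (R : realType) (V : finType) (mu : V -> V -> R) :=
  forall x y, 0 <= mu x y.

Definition arc (R : realType) (V : finType) (mu : V -> V -> R) : rel V :=
  fun x y => 0 < mu x y.

Definition simple_graph (R : realType) (V : finType) (mu : V -> V -> R) :=
  forall x, mu x x = 0.

Definition strongly_connected (R : realType) (V : finType) (mu : V -> V -> R) :=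
  forall x y, connect (arc mu) x y.

Definition has_dipath (R : realType) (V : finType) (mu : V -> V -> R)
    (x y : V) (l : nat) : bool :=
  [exists p : l.-tuple V, path (arc mu) x p && (last x p == y)].

(* The default value 0 is never used on a strongly connected graph. *)
Definition gdist (R : realType) (V : finType) (mu : V -> V -> R)
    (x y : V) : nat :=
  match pselect (exists l, has_dipath mu x y l) with
  | left ex_path => ex_minn ex_path
  | right _ => 0
  end.

Definition grad (R : realType) (V : finType) (mu : V -> V -> R)
    (x y : V) (f : V -> R) : R :=
  (f y - f x) / (gdist mu x y)%:R.

Definition Lip (R : realType) (V : finType) (mu : V -> V -> R)
    (f : V -> R) : R :=
  sup [set r | exists x y, x != y /\ r = grad mu x y f].

Definition vweight (R : realType) (V : finType) (mu : V -> V -> R) (x : V) : R :=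
  \sum_y mu x y.

Definition kernelP (R : realType) (V : finType) (mu : V -> V -> R)
    (x y : V) : R :=
  mu x y / vweight mu x.

(* Probability measures on a finite type are given by their mass functions. *)
Definition prob_mass (R : realType) (T : finType) (p : T -> R) :=
  (forall x, 0 <= p x) /\ \sum_x p x = 1.

Definition is_perron (R : realType) (V : finType) (mu : V -> V -> R)
    (m : V -> R) :=
  prob_mass m /\ forall x, m x = \sum_y m y * kernelP mu y x.

(* On a strongly connected graph with positive vertex weights, is_perron mu   *)
(* holds of exactly one m, which is positive; xget selects it.                *)
Definition perron (R : realType) (V : finType) (mu : V -> V -> R) : V -> R :=
  xget (fun=> 0) [set m | is_perron mu m].

Definition rev_kernelP (R : realType) (V : finType) (mu : V -> V -> R)
    (x y : V) : R :=
  perron mu y / perron mu x * kernelP mu y x.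

Definition mean_kernelP (R : realType) (V : finType) (mu : V -> V -> R)
    (x y : V) : R :=
  2^-1 * (kernelP mu x y + rev_kernelP mu x y).

Definition chung_laplacian (R : realType) (V : finType) (mu : V -> V -> R)
    (f : V -> R) : V -> R :=
  fun x => f x - \sum_y mean_kernelP mu x y * f y.

(* exp(- t L) f, as the pointwise sum of the exponential series
   \sum_n (- t)^n / n! L^n f. *)
Definition heat_semigroup (R : realType) (V : finType) (mu : V -> V -> R)
    (t : R) (f : V -> R) : V -> R :=
  fun x => limn (series (fun n : nat =>
    (- t) ^+ n / n`!%:R * iter n (chung_laplacian mu) f x)).

Definition delta (R : realType) (V : finType) (x : V) : V -> R :=
  fun z => (z == x)%:R.

Definition heat_kernel (R : realType) (V : finType) (mu : V -> V -> R)
    (t : R) (x : V) : V -> R :=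
  fun y => perron mu y / perron mu x * heat_semigroup mu t (delta R x) y.

Definition coupling (R : realType) (V : finType) (nu0 nu1 : V -> R)
    (pi : V * V -> R) :=
  [/\ prob_mass pi,
      forall x, \sum_y pi (x, y) = nu0 x
    & forall y, \sum_x pi (x, y) = nu1 y].

Definition wasserstein (R : realType) (V : finType) (mu : V -> V -> R)
    (nu0 nu1 : V -> R) : R :=
  inf [set c | exists pi : V * V -> R, coupling nu0 nu1 pi /\
               c = \sum_x \sum_y (gdist mu x y)%:R * pi (x, y)].

Definition lazy_step (R : realType) (V : finType) (mu : V -> V -> R)
    (eps : R) (x : V) : V -> R :=
  fun z => (1 - eps) * delta R x z + eps * mean_kernelP mu x z.

Definition curv_eps (R : realType) (V : finType) (mu : V -> V -> R)
    (eps : R) (x y : V) : R :=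
  1 - wasserstein mu (lazy_step mu eps x) (lazy_step mu eps y)
      / (gdist mu x y)%:R.

Definition curv (R : realType) (V : finType) (mu : V -> V -> R) (x y : V) : R :=
  lim (curv_eps mu eps x y / eps @[eps --> 0^'+]).

(* Main.v *)
(* Let W_e be the Wasserstein distance between the lazy steps nu^e_x, nu^e_y.
   Convexity of e |-> W_e makes kappa_e / e nonincreasing, so the curvature is
   a genuine limit and, for any k < K, eventually W_e <= (1 - e k) d; hence
   1 - e L contracts Lip by 1 - e k.  Euler's formula
   P_t = lim (1 - t L / N)^N turns this into (1) => (2).  Reversibility gives
   P_t f (x) = sum_y p^t_x(y) f(y), and Kantorovich duality (proved from the
   Hahn-Banach theorem in finite dimension) yields (2) => (3).  Finally
   nu^t_x and p^t_x agree against 1-Lipschitz functions up to O(t^2), so (3)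
   bounds W_t by e^{-Kt} d + O(t^2), and t -> 0 gives (1). *)

Require Import Defs.
From mathcomp Require Import all_boot all_order all_algebra.
From mathcomp Require Import all_classical all_reals all_analysis.
From mathcomp Require Import ring lra.
Set Implicit Arguments.
Unset Strict Implicit.
Unset Printing Implicit Defensive.
Import Order.TTheory GRing.Theory Num.Theory.
Import numFieldNormedType.Exports.
Local Open Scope classical_set_scope.
Local Open Scope ring_scope.

(** * Finite-dimensional Hahn-Banach theorem and Kantorovich duality *)

Section Sublinear.
Variables (R : realType) (U : lmodType R).
Implicit Types (p q : U -> R) (u v : U).

(** Homogeneity is asked as an inequality only; applying it to the scalar [a^-1] recovers the
    equality in [sublinearZ]. *)
Definition sublinear p :=
  (forall u v, p (u + v) <= p u + p v) /\
  (forall a u, 0 <= a -> p (a *: u) <= a * p u).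

Lemma sublinear0 p : sublinear p -> p 0 = 0.
Proof.
move=> [pD pZ]; apply/eqP; rewrite eq_le.
have := pZ 0 0 (lexx _); rewrite scale0r mul0r => -> /=.
by have := pD 0 0; rewrite addr0 lerDr.
Qed.

Lemma sublinearZ p a u : sublinear p -> 0 <= a -> p (a *: u) = a * p u.
Proof.
move=> sp; rewrite le_eqVlt => /predU1P[<-|a0].
  by rewrite scale0r mul0r sublinear0.
have [_ pZ] := sp; apply/eqP; rewrite eq_le pZ ?(ltW a0)//=.
have := pZ a^-1 (a *: u); rewrite scalerA mulVf ?gt_eqF// scale1r invr_ge0.
by move=> /(_ (ltW a0)); rewrite mulrC ler_pdivlMr // mulrC.
Qed.

(* Passing to the infimum of [p (u + s *: v) - s * p v] over [s >= 0] forces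
   linearity along [v]. *)
Lemma sublinear_linearize p v : sublinear p ->
  exists q, [/\ sublinear q, forall u, q u <= p u & q (- v) <= - p v].
Proof.
move=> sp; have [pD pZ] := sp.
pose S u := [set p (u + s *: v) - s * p v | s in [set s : R | 0 <= s]].
have Slb u : has_inf (S u).
  split; first by exists (p (u + 0 *: v) - 0 * p v), 0 => //=.
  exists (- p (- u)) => _ [s /= s0 <-].
  rewrite -(sublinearZ _ sp)// lerBrDr addrC.
  have := pD (- u) (u + s *: v); rewrite addKr.
  lra.
have Sge u s : 0 <= s -> inf (S u) <= p (u + s *: v) - s * p v.
  by move=> s0; apply: ge_inf; [exact: (Slb u).2 | exists s].
exists (fun u => inf (S u)); split.
- split=> [u w|a u a0].
    rewrite -lerBlDr; apply: lb_le_inf; first exact: (Slb u).1.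
    move=> _ [s /= s0 <-]; rewrite lerBlDl -lerBlDr.
    apply: lb_le_inf; first exact: (Slb w).1.
    move=> _ [t /= t0 <-]; rewrite lerBlDr.
    have := Sge (u + w) (s + t) (addr_ge0 s0 t0).
    have := pD (u + s *: v) (w + t *: v).
    by rewrite addrACA -scalerDl; lra.
  move: a0; rewrite le_eqVlt => /predU1P[<-|a0].
    rewrite scale0r mul0r; have := Sge 0 0 (lexx _).
    by rewrite add0r scale0r mul0r subr0 sublinear0.
  rewrite -ler_pdivrMl//; apply: lb_le_inf; first exact: (Slb u).1.
  move=> _ [s /= s0 <-]; rewrite ler_pdivrMl//.
  have := Sge (a *: u) (a * s) (mulr_ge0 (ltW a0) s0).
  by rewrite -scalerA -scalerDr (sublinearZ _ sp) ?(ltW a0)// -mulrA mulrBr.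
- by move=> u; have := Sge u 0 (lexx _); rewrite scale0r addr0 mul0r subr0.
- by have := Sge (- v) 1 ler01; rewrite scale1r mul1r addNr sublinear0// sub0r.
Qed.

Lemma sublinear_opp_ge p u : sublinear p -> - p u <= p (- u).
Proof.
move=> sp; have [/(_ u (- u)) + _] := sp.
by rewrite subrr sublinear0// => ?; rewrite -subr_ge0 opprK addrC.
Qed.

(** One vector is treated at a time. Passing to a smaller sublinear [r <= q <= p] keeps what is
    gained along [w], since [r (- w) <= q (- w) <= - p w <= - r w]. *)
Lemma sublinear_linearize_seq p (s : seq U) : sublinear p ->
  exists q, [/\ sublinear q, forall u, q u <= p u &
               forall v, v \in s -> q (- v) <= - q v].
Proof.
elim: s p => [|w s IH] p sp; first by exists p; split.
have [q [sq qp qw]] := sublinear_linearize w sp.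
have [r [sr rq rs]] := IH q sq.
exists r; split => // [u|v]; first exact: le_trans (rq u) (qp u).
rewrite inE => /predU1P[->|/rs//].
by rewrite (le_trans (rq _))// (le_trans qw)// lerN2 (le_trans (rq _)).
Qed.

(** With [sublinear_symmetricZ]: the directions along which [q] is linear form a subspace, so a
    spanning family suffices. *)
Lemma sublinear_symmetricD q u v : sublinear q ->
  q (- u) <= - q u -> q (- v) <= - q v -> q (- (u + v)) <= - q (u + v).
Proof.
move=> [qD _] qu qv; rewrite opprD.
by have := qD u v; have := qD (- u) (- v); lra.
Qed.

Lemma sublinear_symmetricZ q a u : sublinear q ->
  q (- u) <= - q u -> q (- (a *: u)) <= - q (a *: u).
Proof.
move=> sq qu; have := sublinear_opp_ge u sq => qu'.
have qN : q (- u) = - q u by apply/eqP; rewrite eq_le qu.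
have [a0|/ltW a0] := leP 0 a.
  by rewrite -scalerN !(sublinearZ _ sq)// qN mulrN.
have Na0 : 0 <= - a by rewrite oppr_ge0.
rewrite -scaleNr (sublinearZ _ sq)//.
by rewrite -[a *: u]opprK -scaleNr -scalerN (sublinearZ _ sq)// qN mulrN opprK.
Qed.

End Sublinear.

Section HahnBanach.
Variables (R : realType) (T : finType).

Theorem hahn_banach_finite (p : (T -> R^o) -> R) (w : T -> R^o) :
  sublinear p ->
  exists l : T -> R, (forall u : T -> R^o, \sum_t u t * l t <= p u) /\
                     \sum_t w t * l t = p w.
Proof.
move=> sp.
pose e t : T -> R^o := fun t' => (t' == t)%:R.
(* Linearizing along [w] before the basis vectors gives [q0 (- w) <= - p w], which survives every
   later decrease and pins the final value at [w] to [p w]. *)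
have [q0 [sq0 q0p q0w]] := sublinear_linearize w sp.
have [q [sq qq0 qe]] := sublinear_linearize_seq [seq e t | t <- enum T] sq0.
have decomp (u : T -> R^o) : u = \sum_t u t *: e t.
  apply/funext => t; rewrite fct_sumE (bigD1 t)//= big1 ?addr0.
    by rewrite /GRing.scale/= /e eqxx /GRing.scale/= mulr1.
  by move=> t' /negPf t't; rewrite /GRing.scale/= /e eq_sym t't /GRing.scale/= mulr0.
have qN (u : T -> R^o) : q (- u) <= - q u.
  rewrite (decomp u).
  elim/big_ind : _ => [|u1 u2 qu1 qu2|t _].
  - by rewrite oppr0 sublinear0// oppr0.
  - exact: sublinear_symmetricD.
  - apply: sublinear_symmetricZ => //; apply: qe.
    by apply/mapP; exists t; rewrite ?mem_enum.
have qNE (u : T -> R^o) : q (- u) = - q u.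
  by apply/eqP; rewrite eq_le qN sublinear_opp_ge.
have qD (u v : T -> R^o) : q (u + v) = q u + q v.
  apply/eqP; rewrite eq_le sq.1 /=.
  by have := sq.1 (- u) (- v); rewrite -opprD !qNE; lra.
have qZ a (u : T -> R^o) : q (a *: u) = a * q u.
  have [a0|/ltW a0] := leP 0 a; first by rewrite (sublinearZ _ sq).
  rewrite -[a *: u]opprK -scaleNr qNE (sublinearZ _ sq) ?oppr_ge0//.
  by rewrite mulNr opprK.
have qE (u : T -> R^o) : \sum_t u t * q (e t) = q u.
  rewrite {2}(decomp u) (big_morph q qD (sublinear0 sq)).
  by apply: eq_bigr => t _; rewrite qZ.
exists (fun t => q (e t)); split=> [u|]; rewrite qE.
  exact: le_trans (qq0 u) (q0p u).
apply/eqP; rewrite eq_le (le_trans (qq0 _) (q0p _))//=.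
rewrite -lerN2 -qNE.
exact: le_trans (qq0 _) q0w.
Qed.

End HahnBanach.

(** * Kantorovich duality on a finite set *)

Section Kantorovich.
Variables (R : realType) (V : finType) (c : V -> V -> R).
Variables (nu0 nu1 : V -> R).
Hypotheses (nu0P : prob_mass nu0) (nu1P : prob_mass nu1).

Definition dual_value (phi psi : V -> R) :=
  \sum_x nu0 x * phi x + \sum_y nu1 y * psi y.

(** The infimum of this set is the dual transport functional of [u]. It is sublinear in [u], and the
    linear functionals below it are couplings. *)
Definition dual_majorants (u : V * V -> R^o) : set R :=
  [set r | exists phi psi : V -> R,
    (forall x y, u (x, y) <= phi x + psi y) /\ r = dual_value phi psi].

Lemma coupling_product : coupling nu0 nu1 (fun z => nu0 z.1 * nu1 z.2).
Proof.
have [n0 s0] := nu0P; have [n1 s1] := nu1P.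
have rowE x : \sum_y nu0 x * nu1 y = nu0 x by rewrite -mulr_sumr s1 mulr1.
split=> [|x|y] /=; [|exact: rowE|by rewrite -mulr_suml s0 mul1r].
split=> [z|]; first by rewrite mulr_ge0.
rewrite -(pair_bigA _ (fun x y => nu0 x * nu1 y))/= -s0.
by apply: eq_bigr => x _; exact: rowE.
Qed.

Lemma coupling_dual_value pi (phi psi : V -> R) : coupling nu0 nu1 pi ->
  dual_value phi psi = \sum_x \sum_y pi (x, y) * (phi x + psi y).
Proof.
move=> [_ pi0 pi1]; rewrite /dual_value.
under [RHS]eq_bigr do (under eq_bigr do rewrite mulrDr; rewrite big_split/=).
rewrite big_split/=; congr (_ + _).
  by apply: eq_bigr => x _; rewrite -pi0 mulr_suml.
by rewrite exchange_big/=; apply: eq_bigr => y _; rewrite -pi1 mulr_suml.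
Qed.

(** A large constant majorizes [u]; the integral of [u] against the product coupling is a lower
    bound. *)
Lemma dual_majorants_inf u : has_inf (dual_majorants u).
Proof.
split.
  exists (dual_value (fun=> \sum_z `|u z|) (fun=> 0)).
  exists (fun=> \sum_z `|u z|), (fun=> 0); split => // x y.
  rewrite addr0 (le_trans (ler_norm _))// (bigD1 (x, y))//= lerDl.
  by rewrite sumr_ge0.
exists (\sum_x \sum_y nu0 x * nu1 y * u (x, y)).
move=> _ [phi [psi [upp ->]]].
rewrite (coupling_dual_value _ _ coupling_product)/=.
apply: ler_sum => x _; apply: ler_sum => y _.
by rewrite ler_wpM2l// mulr_ge0// ?nu0P.1 ?nu1P.1.
Qed.

Lemma dual_majorants_ge u phi psi :
  (forall x y, u (x, y) <= phi x + psi y) ->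
  inf (dual_majorants u) <= dual_value phi psi.
Proof.
by move=> upp; apply: ge_inf; [exact: (dual_majorants_inf u).2|exists phi, psi].
Qed.

Lemma dual_majorants_sublinear : sublinear (fun u => inf (dual_majorants u)).
Proof.
have inf_ne u := (dual_majorants_inf u).1.
split=> [u v|a u a0].
  rewrite -lerBlDr; apply: lb_le_inf => // _ [phi [psi [upp ->]]].
  rewrite lerBlDl -lerBlDr; apply: lb_le_inf => // _ [phi' [psi' [vpp ->]]].
  rewrite lerBlDl.
  suff -> : dual_value phi psi + dual_value phi' psi' =
            dual_value (phi \+ phi') (psi \+ psi').
    by apply: dual_majorants_ge => x y /=; rewrite addrACA lerD.
  rewrite /dual_value addrACA.
  by congr (_ + _); rewrite -big_split/=; apply: eq_bigr => x _; rewrite mulrDr.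
have ge_scale phi psi : (forall x y, u (x, y) <= phi x + psi y) ->
    inf (dual_majorants (a *: u)) <= a * dual_value phi psi.
  move=> upp.
  suff -> : a * dual_value phi psi =
      dual_value (fun x => a * phi x) (fun y => a * psi y).
    by apply: dual_majorants_ge => x y; rewrite -mulrDr ler_wpM2l.
  rewrite /dual_value mulrDr !mulr_sumr.
  by congr (_ + _); apply: eq_bigr => x _; rewrite mulrCA.
(* The bound on the infimum divides by [a], so [a = 0] is treated apart, with an arbitrary
   majorant. *)
move: a0; rewrite le_eqVlt => /predU1P[a0|a0]; last first.
  rewrite -ler_pdivrMl//; apply: lb_le_inf => // _ [phi [psi [upp ->]]].
  by rewrite ler_pdivrMl//; exact: ge_scale.
have [_ [phi [psi [upp _]]]] := inf_ne u.
by move: (ge_scale _ _ upp); rewrite -{2}a0 !mul0r -a0 mul0r.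
Qed.

Hypotheses (c_refl : forall x, c x x = 0)
  (c_triangle : forall x y z, c x z <= c x y + c y z).

(** Hahn-Banach, applied to the dual functional at [- c], yields a [pi] whose cost is the dual
    optimum. Functions of one coordinate test its marginals and nonpositive functions its sign; the
    c-transform turns a dual pair into one Lipschitz function. *)
Lemma kantorovich_duality (C : R) :
  (forall f : V -> R, (forall x y, f y - f x <= c x y) ->
     \sum_y nu1 y * f y - \sum_x nu0 x * f x <= C) ->
  exists pi, coupling nu0 nu1 pi /\ \sum_x \sum_y c x y * pi (x, y) <= C.
Proof.
move=> dualC.
pose w : V * V -> R^o := fun z => - c z.1 z.2.
have [pi [pi_le pi_w]] := hahn_banach_finite w dual_majorants_sublinear.
have pairE (g : V * V -> R) (u : V * V -> R) :
    \sum_z u z * g z = \sum_x \sum_y u (x, y) * g (x, y).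
  by rewrite pair_bigA/=; apply: eq_bigr => -[].
(* The indicator of the row [x] scaled by [1] and by [-1] gives the two inequalities. *)
have marg0 x : \sum_y pi (x, y) = nu0 x.
  have sumE a : \sum_z (a * (z.1 == x)%:R) * pi z = a * \sum_y pi (x, y).
    rewrite pairE (bigD1 x)//= [X in _ + X]big1 ?addr0 => [|x' /negPf ->].
      by rewrite mulr_sumr; apply: eq_bigr => y _; rewrite eqxx mulr1.
    by rewrite big1// => y _; rewrite mulr0 mul0r.
  have le a : a * \sum_y pi (x, y) <= a * nu0 x.
    rewrite -sumE; apply: le_trans (pi_le (fun z => a * (z.1 == x)%:R)) _.
    have -> : a * nu0 x = dual_value (fun x' => a * (x' == x)%:R) (fun=> 0).
      rewrite /dual_value [X in _ + X]big1 ?addr0; last by move=> *; rewrite mulr0.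
      rewrite (bigD1 x)//= [X in _ + X]big1 ?addr0 => [|x' /negPf ->].
        by rewrite eqxx mulr1 mulrC.
      by rewrite !mulr0.
    by apply: dual_majorants_ge => x' y /=; rewrite addr0.
  by apply/eqP; rewrite eq_le; have := le 1; have := le (-1); lra.
have marg1 y : \sum_x pi (x, y) = nu1 y.
  have sumE a : \sum_z (a * (z.2 == y)%:R) * pi z = a * \sum_x pi (x, y).
    rewrite pairE exchange_big/= (bigD1 y)//=.
    rewrite [X in _ + X]big1 ?addr0 => [|y' /negPf ->].
      by rewrite mulr_sumr; apply: eq_bigr => x _; rewrite eqxx mulr1.
    by rewrite big1// => x _; rewrite mulr0 mul0r.
  have le a : a * \sum_x pi (x, y) <= a * nu1 y.
    rewrite -sumE; apply: le_trans (pi_le (fun z => a * (z.2 == y)%:R)) _.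
    have -> : a * nu1 y = dual_value (fun=> 0) (fun y' => a * (y' == y)%:R).
      rewrite /dual_value [X in X + _]big1 ?add0r; last by move=> *; rewrite mulr0.
      rewrite (bigD1 y)//= [X in _ + X]big1 ?addr0 => [|y' /negPf ->].
        by rewrite eqxx mulr1 mulrC.
      by rewrite !mulr0.
    by apply: dual_majorants_ge => x y' /=; rewrite add0r.
  by apply/eqP; rewrite eq_le; have := le 1; have := le (-1); lra.
(* Minus the indicator of [z] is majorized by the zero pair, of dual value [0]. *)
have pi_ge0 z : 0 <= pi z.
  have := pi_le (fun z' => - (z' == z)%:R).
  rewrite (bigD1 z)//= [X in _ + X]big1 ?addr0 => [|z' /negPf ->]; last first.
    by rewrite oppr0 mul0r.
  rewrite eqxx mulN1r -oppr_le0 => /le_trans; apply.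
  suff <- : dual_value (fun=> 0) (fun=> 0) = 0.
    by apply: dual_majorants_ge => x y; rewrite addr0 oppr_le0.
  by rewrite /dual_value !big1 ?addr0// => *; rewrite mulr0.
exists pi; split.
  split => //; split => //.
  rewrite -nu0P.2 -(eq_bigr _ (fun x _ => marg0 x)) pair_bigA.
  by apply: eq_bigr => -[].
have -> : \sum_x \sum_y c x y * pi (x, y) = - \sum_z w z * pi z.
  rewrite pairE -sumrN; apply: eq_bigr => x _; rewrite -sumrN.
  by apply: eq_bigr => y _; rewrite mulNr opprK.
rewrite pi_w lerNl; apply: lb_le_inf; first exact: (dual_majorants_inf w).1.
move=> _ [phi [psi [wpp ->]]].
(* The c-transform of [phi] is 1-Lipschitz and separates [- psi] and [phi]. *)
pose S y := [set c x y + phi x | x in [set: V]].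
have Slb y : lbound (S y) (- psi y).
  by move=> _ [x _ <-]; have := wpp x y; rewrite /w/=; lra.
have Sinf x y : inf (S y) <= c x y + phi x.
  by apply: ge_inf; [exists (- psi y); exact: Slb | exists x].
have Slip x y : inf (S y) - inf (S x) <= c x y.
  rewrite lerBlDr -lerBlDl; apply: lb_le_inf; first by exists (c x x + phi x), x.
  move=> _ [z _ <-]; rewrite lerBlDl; apply: le_trans (Sinf z y) _.
  by have := c_triangle z x y; lra.
have := dualC _ Slip; apply: contraTT; rewrite -!ltNge => lt_C.
have le1 : - \sum_y nu1 y * psi y <= \sum_y nu1 y * inf (S y).
  rewrite -sumrN; apply: ler_sum => y _; rewrite -mulrN ler_wpM2l ?nu1P.1//.
  by apply: lb_le_inf (Slb y); exists (c y y + phi y), y.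
have le0 : \sum_x nu0 x * inf (S x) <= \sum_x nu0 x * phi x.
  apply: ler_sum => x _; rewrite ler_wpM2l ?nu0P.1//.
  by have := Sinf x x; rewrite c_refl add0r.
by rewrite /dual_value in lt_C; lra.
Qed.

End Kantorovich.

(** * Graph distance and Perron measure *)

Section Graph.
Variables (R : realType) (V : finType) (mu : V -> V -> R).
Hypothesis mu_sc : strongly_connected mu.

Let d x y : R := (gdist mu x y)%:R.

Lemma gdist_dipath x y : has_dipath mu x y (gdist mu x y).
Proof.
rewrite /gdist; case: pselect => [ex|]; first by case: ex_minnP.
case; have /connectP[p xp ->] := mu_sc x y.
by exists (size p); apply/existsP; exists (in_tuple p); rewrite xp /=.
Qed.

Lemma gdist_min x y l : has_dipath mu x y l -> (gdist mu x y <= l)%N.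
Proof.
move=> xyl; rewrite /gdist; case: pselect => // ex.
by case: ex_minnP => n _; exact.
Qed.

Lemma gdistxx x : gdist mu x x = 0%N.
Proof.
apply/eqP; rewrite -leqn0; apply: gdist_min.
by apply/existsP; exists [tuple]; rewrite /= eqxx.
Qed.

Lemma gdist_gt0 x y : x != y -> (0 < gdist mu x y)%N.
Proof.
rewrite lt0n; apply: contraNneq => xy0.
by have := gdist_dipath x y; rewrite xy0 => /existsP[p]; rewrite tuple0.
Qed.

Lemma gdist_triangle x y z : (gdist mu x z <= gdist mu x y + gdist mu y z)%N.
Proof.
have /existsP[p /andP[xp /eqP lp]] := gdist_dipath x y.
have /existsP[q /andP[yq lq]] := gdist_dipath y z.
apply: gdist_min; apply/existsP; exists [tuple of p ++ q].
by rewrite cat_path last_cat lp xp yq.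
Qed.

Lemma grad_has_ubound (f : V -> R) :
  has_ubound [set r | exists x y, x != y /\ r = grad mu x y f].
Proof.
exists (\sum_x \sum_y `|grad mu x y f|) => _ [x [y [_ ->]]].
rewrite (bigD1 x)//= (bigD1 y)//= -addrA (le_trans (ler_norm _))// lerDl.
by rewrite addr_ge0// sumr_ge0// => *; rewrite sumr_ge0.
Qed.

Lemma Lip_grad f x y : x != y -> grad mu x y f <= Lip mu f.
Proof.
by move=> xy; apply: ub_le_sup; [exact: grad_has_ubound | exists x, y].
Qed.

Lemma sub_le_Lip f x y : f y - f x <= Lip mu f * d x y.
Proof.
have [->|xy] := eqVneq x y; first by rewrite /d gdistxx mulr0 subrr.
by rewrite -ler_pdivrMr ?ltr0n ?gdist_gt0//; exact: Lip_grad.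
Qed.

(** The bound [0 <= C] covers the case without distinct vertices, where the supremum of the empty
    set is [0]. *)
Lemma Lip_le f C : 0 <= C ->
  (forall x y, x != y -> f y - f x <= C * d x y) -> Lip mu f <= C.
Proof.
move=> C0 fC.
have [[r Sr]|S0] :=
    pselect ([set r | exists x y, x != y /\ r = grad mu x y f] !=set0).
  apply: ge_sup; first by exists r.
  move=> _ [x [y [xy ->]]].
  by rewrite /grad ler_pdivrMr ?ltr0n ?gdist_gt0//; exact: fC.
by rewrite /Lip (_ : [set _ | _] = set0) ?sup0//; apply/nonemptyPn.
Qed.

(** Of the two gradients between distinct vertices, in either direction, one is nonnegative. *)
Lemma Lip_ge0 f : 0 <= Lip mu f.
Proof.
have [[r [x [y [xy _]]]]|S0] :=
    pselect ([set r | exists x y, x != y /\ r = grad mu x y f] !=set0); last first.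
  by rewrite /Lip (_ : [set _ | _] = set0) ?sup0//; apply/nonemptyPn.
wlog fxy : x y xy / f x <= f y => [hw|].
  by have [fxy|/ltW fyx] := leP (f x) (f y); [exact: (hw x y)|];
    apply: (hw y x) => //; rewrite eq_sym.
by apply: le_trans (Lip_grad f xy); rewrite /grad divr_ge0// subr_ge0.
Qed.

Lemma wasserstein_has_inf nu0 nu1 : prob_mass nu0 -> prob_mass nu1 ->
  has_inf [set c | exists pi : V * V -> R, coupling nu0 nu1 pi /\
                   c = \sum_x \sum_y (gdist mu x y)%:R * pi (x, y)].
Proof.
move=> n0 n1; split.
  by eexists; eexists; split; [exact: (coupling_product n0 n1)|reflexivity].
exists 0 => _ [pi [[[pi0 _] _ _] ->]].
by apply: sumr_ge0 => x _; apply: sumr_ge0 => y _; rewrite mulr_ge0.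
Qed.

(** The hard half of duality: upper bounds on the distance need only test functions, never an
    explicit coupling. *)
Lemma wasserstein_le (nu0 nu1 : V -> R) C : prob_mass nu0 -> prob_mass nu1 ->
  (forall f : V -> R, (forall x y, f y - f x <= d x y) ->
     \sum_y nu1 y * f y - \sum_x nu0 x * f x <= C) ->
  wasserstein mu nu0 nu1 <= C.
Proof.
move=> n0 n1 dualC.
have [|x y z|pi [cpi piC]] := kantorovich_duality n0 n1 _ _ dualC.
- by move=> x; rewrite /d gdistxx.
- by rewrite /d -natrD ler_nat gdist_triangle.
- apply: le_trans piC; apply: ge_inf; first exact: (wasserstein_has_inf n0 n1).2.
  by exists pi.
Qed.

(** The easy half of duality: integrate the Lipschitz inequality against each coupling. *)
Lemma sub_le_wasserstein (nu0 nu1 : V -> R) L (f : V -> R) :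
  prob_mass nu0 -> prob_mass nu1 -> 0 <= L ->
  (forall x y, f y - f x <= L * d x y) ->
  \sum_y nu1 y * f y - \sum_x nu0 x * f x <= L * wasserstein mu nu0 nu1.
Proof.
move=> n0 n1 L0 fL.
have le_cost pi : coupling nu0 nu1 pi ->
    \sum_y nu1 y * f y - \sum_x nu0 x * f x
      <= L * \sum_x \sum_y d x y * pi (x, y).
  move=> cpi; have [[pi0 _] _ _] := cpi.
  have := coupling_dual_value (fun x => - f x) f cpi.
  rewrite /dual_value; under eq_bigr do rewrite mulrN.
  rewrite sumrN addrC => ->; rewrite mulr_sumr; apply: ler_sum => x _.
  rewrite mulr_sumr; apply: ler_sum => y _.
  by rewrite mulrA [_ * pi _]mulrC ler_wpM2l// addrC.
have [ne _] := wasserstein_has_inf n0 n1.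
move: L0; rewrite le_eqVlt => /predU1P[L0|L0].
  have [_ [pi [cpi _]]] := ne; rewrite -L0 mul0r.
  by have := le_cost _ cpi; rewrite -L0 mul0r.
rewrite -ler_pdivrMl//; apply: lb_le_inf => // _ [pi [cpi ->]].
by rewrite ler_pdivrMl//; exact: le_cost.
Qed.

(** * Transition kernels and the Perron measure *)

Hypothesis mu_ge0 : nonneg_weight mu.
Hypothesis mu_vw : forall x : V, 0 < vweight mu x.

Lemma kernelP_ge0 x y : 0 <= kernelP mu x y.
Proof. by rewrite divr_ge0// ltW. Qed.

Lemma kernelP_gt0 x y : Defs.arc mu x y -> 0 < kernelP mu x y.
Proof. by move=> xy; rewrite divr_gt0. Qed.

Lemma sum_kernelP x : \sum_y kernelP mu x y = 1.
Proof. by rewrite /kernelP -mulr_suml mulfV// gt_eqF// mu_vw. Qed.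

(* A left null vector of [1 - P] exists because [1 - P] kills constants; its
   absolute value is again invariant since [P] preserves the total mass. *)
Lemma ex_perron (x0 : V) : exists m, is_perron mu m.
Proof.
pose M := \matrix_(i < #|V|, j < #|V|)
  ((i == j)%:R - kernelP mu (enum_val i) (enum_val j)).
have sum_ord (F : V -> R) : \sum_(i < #|V|) F (enum_val i) = \sum_y F y.
  by rewrite [RHS](reindex (@enum_val V V))//; exact/onW_bij/enum_val_bij.
have sum_eq (F : V -> R) i : \sum_j F j * (j == i)%:R = F i.
  by rewrite (bigD1 i)//= eqxx mulr1 big1 ?addr0// => j /negPf ->; rewrite mulr0.
have : \det M == 0.
  (* [det0P] speaks of left null vectors, while constants are killed from the right; hence the
     transposition. *)
  rewrite -det_tr; apply/det0P; exists (const_mx 1).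
    apply/eqP => /matrixP/(_ ord0 (enum_rank x0)); rewrite !mxE.
    by apply/eqP; rewrite oner_eq0.
  apply/matrixP => i j; rewrite !mxE.
  under eq_bigr do rewrite !mxE mul1r.
  rewrite sumrB (sum_ord (fun y => kernelP mu (enum_val j) y)) sum_kernelP.
  rewrite (bigD1 j)//= eqxx big1 ?addr0 ?subrr// => k.
  by rewrite eq_sym => /negPf ->.
move=> /det0P[v v0 vM].
pose w x := v ord0 (enum_rank x).
have wE x : w x = \sum_y w y * kernelP mu y x.
  apply/eqP; rewrite -subr_eq0; apply/eqP.
  have /matrixP/(_ ord0 (enum_rank x)) := vM; rewrite !mxE => vMx.
  rewrite -[RHS]vMx.
  rewrite -[X in X - _](sum_eq w).
  rewrite -sumrB -sum_ord; apply: eq_bigr => i _.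
  by rewrite !mxE /w enum_valK enum_rankK -mulrBr -(inj_eq enum_rank_inj) enum_valK.
have [x1 wx1] : exists x, w x != 0.
  apply/existsP; apply: contraNT v0 => /existsPn w0.
  apply/eqP/matrixP => i j; rewrite ord1 mxE; apply/eqP.
  by have := w0 (enum_val j); rewrite /w enum_valK negbK.
have le_abs x : `|w x| <= \sum_y `|w y| * kernelP mu y x.
  rewrite {1}wE (le_trans (ler_norm_sum _ _ _))//; apply: ler_sum => y _.
  by rewrite normrM [`|kernelP _ _ _|]ger0_norm ?kernelP_ge0.
have absE x : `|w x| = \sum_y `|w y| * kernelP mu y x.
  apply/eqP; rewrite eq_sym -subr_eq0.
  have : \sum_x (\sum_y `|w y| * kernelP mu y x - `|w x|) == 0.
    rewrite sumrB exchange_big/= subr_eq0; apply/eqP/eq_bigr => y _.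
    by rewrite -mulr_sumr sum_kernelP mulr1.
  rewrite psumr_eq0 => [/allP/(_ x)|y _]; last by rewrite subr_ge0.
  by rewrite mem_index_enum; exact.
have w_gt0 : 0 < \sum_y `|w y|.
  by rewrite (bigD1 x1)//= ltr_pwDl ?normr_gt0// sumr_ge0.
exists (fun x => `|w x| / \sum_y `|w y|); split; first split.
- by move=> x; rewrite divr_ge0// ltW.
- by rewrite -mulr_suml divff// gt_eqF.
- move=> x; rewrite absE mulr_suml.
  by apply: eq_bigr => y _; rewrite mulrAC.
Qed.

(** The vertex [x0] witnesses that [V] is nonempty, without which no probability measure exists. *)
Lemma perronP (x0 : V) : is_perron mu (perron mu).
Proof.
have [m mP] := ex_perron x0.
exact: (@xgetI _ _ [set m | is_perron mu m] m mP).
Qed.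

(** Some vertex has positive mass because the total is 1, and invariance carries positivity along
    each arc of a path to [x]. *)
Lemma perron_gt0 x : 0 < perron mu x.
Proof.
have [[m_ge0 m_sum] mE] := perronP x.
have [x0 mx0] : exists x0, 0 < perron mu x0.
  apply/not_existsP => m0; move: m_sum; rewrite big1 => [/eqP|y _].
    by rewrite eq_sym oner_eq0.
  by apply/eqP; rewrite eq_le m_ge0 andbT leNgt; apply/negP/m0.
have /connectP[p x0p ->] := mu_sc x0 x.
elim: p x0 mx0 x0p => //= y p IH x0 mx0 /andP[x0y yp]; apply: IH => //.
rewrite mE (bigD1 x0)//= ltr_pwDl//; first exact: mulr_gt0 mx0 (kernelP_gt0 x0y).
by apply: sumr_ge0 => z _; rewrite mulr_ge0 ?kernelP_ge0.
Qed.

Local Notation Q := (mean_kernelP mu).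

Lemma mean_kernelP_ge0 x y : 0 <= Q x y.
Proof.
by rewrite mulr_ge0 ?invr_ge0// addr_ge0 ?kernelP_ge0// mulr_ge0 ?kernelP_ge0//
  divr_ge0// ltW ?perron_gt0.
Qed.

(** Invariance of the Perron measure says exactly that the reversed kernel has row sums 1. *)
Lemma sum_mean_kernelP x : \sum_y Q x y = 1.
Proof.
rewrite -mulr_sumr big_split/= sum_kernelP.
have -> : \sum_y rev_kernelP mu x y = 1.
  under eq_bigr do rewrite /rev_kernelP mulrAC.
  by rewrite -mulr_suml -(perronP x).2 divff// gt_eqF ?perron_gt0.
by rewrite -[1 + 1]/(2%:R) mulVf// pnatr_eq0.
Qed.

(** Detailed balance, the source of the self-adjointness used in [iter_lazy_op_sym]. *)
Lemma mean_kernelP_reversible x y :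
  perron mu x * Q x y = perron mu y * Q y x.
Proof.
rewrite /mean_kernelP /rev_kernelP.
have mx : perron mu x != 0 by rewrite gt_eqF ?perron_gt0.
have my : perron mu y != 0 by rewrite gt_eqF ?perron_gt0.
by field; rewrite mx my.
Qed.

End Graph.

(** * The heat semigroup *)

(** Pascal's rule, read as [(1 + a S)^(N+1) = (1 + a S)^N + a (1 + a S)^N S] for the shift [S] of
    sequences. *)
Lemma binomial_shift (R : comNzRingType) (g : nat -> R) (a : R) N :
  \sum_(n < N.+2) 'C(N.+1, n)%:R * a ^+ n * g n =
  \sum_(n < N.+1) 'C(N, n)%:R * a ^+ n * g n +
  a * \sum_(n < N.+1) 'C(N, n)%:R * a ^+ n * g n.+1.
Proof.
rewrite big_ord_recl/= !bin0 mulr_sumr.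
under eq_bigr => i _.
  rewrite /bump/= add1n binS natrD mulrDl mulrDl exprS [X in _ + X](_ : _ =
    a * ('C(N, i)%:R * a ^+ i * g i.+1)); last by ring.
  over.
rewrite big_split/= addrA; congr (_ + _).
rewrite [RHS]big_ord_recl/= !bin0; congr (_ + _).
rewrite big_ord_recr/= bin_small// !mul0r addr0.
by apply: eq_bigr => i _; rewrite /bump/= add1n exprS.
Qed.

(** For [n <= N] the ratio is the product of the factors [1 - k / N] over [k < n]; each costs at
    most [k / N], and these losses add up to at most [n^2 / N]. *)
Lemma ffact_ratio (R : realFieldType) (N n : nat) : (0 < N)%N ->
  1 - (n ^ 2)%:R / N%:R <= (N ^_ n)%:R / N%:R ^+ n :> R /\
  (N ^_ n)%:R / N%:R ^+ n <= 1 :> R.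
Proof.
move=> N0; have N0' : 0 < N%:R :> R by rewrite ltr0n.
elim: n => [|n [lo hi]].
  by rewrite ffactn0 expr0 divr1 exp0n// mul0r subr0.
have w0 : 0 <= (N ^_ n)%:R / N%:R ^+ n :> R by rewrite divr_ge0// exprn_ge0.
rewrite ffactnSr natrM exprSr invfM mulrACA; split; last first.
  rewrite -[leRHS]mulr1 ler_pM// ?divr_ge0// ler_pdivrMr// mul1r ler_nat.
  exact: leq_subr.
set w := _ / _ ^+ n in lo hi w0 *.
(* Only an inequality, since the subtraction on [nat] is truncated when [n > N]. *)
have le_sub : 1 - n%:R / N%:R <= (N - n)%:R / N%:R :> R.
  rewrite ler_pdivlMr// mulrBl mul1r divfK ?gt_eqF//.
  by rewrite lerBlDr -natrD ler_nat addnC -leq_subLR.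
have : w * (1 - n%:R / N%:R) <= w * ((N - n)%:R / N%:R) by rewrite ler_wpM2l.
apply: le_trans; rewrite mulrBr mulr1.
have : w * (n%:R / N%:R) <= n%:R / N%:R.
  by rewrite -[leRHS]mul1r ler_wpM2r// divr_ge0.
have -> : ((n.+1 ^ 2)%:R : R) = (n ^ 2)%:R + 2 * n%:R + 1.
  by rewrite !natrX -natr1; ring.
have : 0 <= n%:R / N%:R :> R by rewrite divr_ge0.
have : 0 <= N%:R^-1 :> R by rewrite invr_ge0 ltW.
rewrite !mulrDl mul1r; lra.
Qed.

Lemma lim_dist_le (R : realType) (u : R^nat) (l c B : R) :
  u n @[n --> \oo] --> l -> (\forall n \near \oo, `|u n - c| <= B) ->
  `|l - c| <= B.
Proof.
move=> ul uB; apply: (@cvgr_to_le _ \oo _ _ (fun n => `|u n - c|)) => //.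
by apply: cvg_norm; apply: cvgB => //; exact: cvg_cst.
Qed.

Lemma series_exp_coeff_le (R : realType) (x : R) n : 0 <= x ->
  \sum_(0 <= k < n) x ^+ k / k`!%:R <= expR x.
Proof.
move=> x0; apply: (@nondecreasing_cvgn_le _ (series (exp_coeff x))).
  by apply: nondecreasing_series => k _ _; exact: exp_coeff_ge0.
exact: is_cvg_series_exp_coeff.
Qed.

(** From [1 + s <= expR s] and [(1 + s) (1 - s + 2 s^2) = 1 + s^2 (1 + 2 s)], which is at least 1
    for [s >= -1/2]. *)
Lemma expRN_le_quadratic (R : realType) (s : R) :
  - 2^-1 <= s -> expR (- s) <= 1 - s + 2 * s ^+ 2.
Proof.
move=> s2; have s1 : 0 < 1 + s by lra.
rewrite expRN (@le_trans _ _ (1 + s)^-1)//.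
  by rewrite lef_pV2 ?posrE ?expR_gt0// expR_ge1Dx.
by rewrite -[_^-1]mul1r ler_pdivrMr//; nra.
Qed.

Lemma near_right0_shrink (R : realType) (P : set R) (t : R) : 0 < t ->
  (\forall e \near 0^'+, P e) -> \forall N \near \oo, P (t / N.+1%:R).
Proof.
move=> t0 nearP.
have cvg0 : t / N.+1%:R @[N --> \oo] --> (0 : R).
  by rewrite -(mulr0 t); apply: cvgM; [exact: cvg_cst|exact: cvg_harmonic].
have : \forall e \near (0 : R), 0 < e -> P e := nearP.
move=> /cvg0 near_seq; apply: (@filterS _ \oo _ _ _ _ near_seq) => N /=.
by apply; exact: divr_gt0.
Qed.

Section Heat.
Variables (R : realType) (V : finType) (mu : V -> V -> R).
Hypotheses (mu_sc : strongly_connected mu) (mu_ge0 : nonneg_weight mu).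
Hypothesis mu_vw : forall x : V, 0 < vweight mu x.
Implicit Types (f g : V -> R) (x y : V) (t a F : R).

Local Notation L := (chung_laplacian mu).
Local Notation Q := (mean_kernelP mu).
Local Notation m := (perron mu).
Let Q_ge0 := mean_kernelP_ge0 mu_sc mu_ge0 mu_vw.
Let Q_sum := sum_mean_kernelP mu_sc mu_ge0 mu_vw.

(** [L] is the identity minus an average, so its sup norm is at most 2. *)
Lemma norm_iter_laplacian_le f F n x :
  (forall y, `|f y| <= F) -> `|iter n L f x| <= 2 ^+ n * F.
Proof.
move=> fF; elim: n x => [|n IH] x; first by rewrite mul1r.
have -> : 2 ^+ n.+1 * F = 2 ^+ n * F + 2 ^+ n * F by rewrite exprS; ring.
rewrite iterS {1}/chung_laplacian.
rewrite (le_trans (ler_normB _ _))// lerD// (le_trans (ler_norm_sum _ _ _))//.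
rewrite -[leRHS]mul1r -[X in X * _](Q_sum x) mulr_suml; apply: ler_sum => y _.
by rewrite normrM ger0_norm// ler_wpM2l.
Qed.

Lemma iter_laplacianD f g a n x :
  iter n L (fun y => f y + a * g y) x = iter n L f x + a * iter n L g x.
Proof.
have LE h z : L h z = h z - \sum_y Q z y * h y by [].
elim: n x => [//|n IH] x; rewrite !iterS !LE IH.
under eq_bigr do rewrite IH mulrDr [_ * (a * _)]mulrCA.
by rewrite big_split/= -mulr_sumr; ring.
Qed.

Definition heat_coeff t f x : R^nat :=
  fun n => (- t) ^+ n / n`!%:R * iter n L f x.

Lemma norm_heat_coeff_le t f F x n : (forall y, `|f y| <= F) ->
  `|heat_coeff t f x n| <= (`|t| * 2) ^+ n / n`!%:R * F.
Proof.
move=> fF; rewrite /heat_coeff normrM normrM normrX normrN.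
rewrite [`|_^-1|]ger0_norm ?invr_ge0// exprMn -!mulrA ler_wpM2l ?exprn_ge0//.
by rewrite mulrCA ler_wpM2l ?invr_ge0//; exact: norm_iter_laplacian_le.
Qed.

Lemma bounded_fin f : exists2 F : R, 0 <= F & forall y, `|f y| <= F.
Proof.
exists (\sum_y `|f y|) => [|y]; first by rewrite sumr_ge0.
by rewrite (bigD1 y)//= lerDl sumr_ge0.
Qed.

Lemma cvg_heat_semigroup t f x :
  series (heat_coeff t f x) n @[n --> \oo] --> heat_semigroup mu t f x.
Proof.
have [F F0 fF] := bounded_fin f.
(* [heat_semigroup] is by definition the [limn] of this series, so existence of the limit is
   enough. *)
suff : cvgn (series (heat_coeff t f x)) by [].
apply: normed_cvg; apply: (@series_le_cvg _ _ (F *: exp_coeff (`|t| * 2))).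
- by move=> n; exact: normr_ge0.
- by move=> n; rewrite mulr_ge0// exp_coeff_ge0// mulr_ge0.
- by move=> n; rewrite (le_trans (norm_heat_coeff_le _ _ _ fF))// mulrC.
- exact/is_cvg_seriesZ/is_cvg_series_exp_coeff.
Qed.

(** For [t <= 1] every term of index [k >= 2] has [t^k <= t^2]; what remains is bounded by the
    exponential series at 2. *)
Lemma heat_semigroup_order2 t f F x : (forall y, `|f y| <= F) -> 0 <= t <= 1 ->
  `|heat_semigroup mu t f x - (f x - t * L f x)| <= t ^+ 2 * (expR 2 * F).
Proof.
move=> fF /andP[t0 t1]; have F0 : 0 <= F by apply: le_trans (fF x).
apply: (lim_dist_le (cvg_heat_semigroup (t:=t) (f:=f) (x:=x))).
near=> n; have n2 : (2 <= n)%N by near: n; exact: nbhs_infty_ge.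
have -> : f x - t * L f x = series (heat_coeff t f x) 2.
  rewrite /series/= big_nat_recr//= big_nat1 /heat_coeff/= expr0 expr1.
  by rewrite !divr1 mul1r mulNr.
rewrite sub_series_geq// (le_trans (ler_norm_sum _ _ _))//.
apply: (@le_trans _ _ (\sum_(2 <= k < n) t ^+ 2 * (2 ^+ k / k`!%:R * F))).
  apply: ler_sum_nat => k /andP[k2 _].
  apply: le_trans (norm_heat_coeff_le _ _ _ fF) _.
  have -> : (`|t| * 2) ^+ k / k`!%:R * F = t ^+ k * (2 ^+ k / k`!%:R * F).
    by rewrite ger0_norm// exprMn; ring.
  rewrite ler_wpM2r//.
    by rewrite mulr_ge0// ?exprn_ge0// mulr_ge0// invr_ge0.
  by rewrite ler_wiXn2l.
rewrite -mulr_sumr ler_wpM2l ?exprn_ge0// -mulr_suml ler_wpM2r//.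
apply: le_trans (series_exp_coeff_le n _) => //.
rewrite [leRHS](@big_cat_nat _ _ _ 2)//= lerDr.
by apply: sumr_ge0 => k _; rewrite divr_ge0// exprn_ge0.
Unshelve. all: by end_near. Qed.

Lemma sum_delta f x : \sum_z delta R x z * f z = f x.
Proof.
rewrite (bigD1 x)//= /delta eqxx mul1r big1 ?addr0// => z /negPf ->.
by rewrite mul0r.
Qed.

(** This is the Euler step [1 - a L] ([lazy_opE]), written as an average so that Wasserstein bounds
    apply. *)
Definition lazy_op a f : V -> R := fun x => \sum_z lazy_step mu a x z * f z.

Lemma lazy_opE a f x : lazy_op a f x = f x - a * L f x.
Proof.
rewrite /lazy_op /lazy_step.
under eq_bigr do rewrite mulrDl -(mulrA (1 - a)) -(mulrA a (Q _ _)).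
by rewrite big_split/= -!mulr_sumr sum_delta /chung_laplacian; ring.
Qed.

Lemma lazy_step_prob a x : 0 <= a <= 1 -> prob_mass (lazy_step mu a x).
Proof.
move=> /andP[a0 a1]; split=> [z|].
  by rewrite addr_ge0// mulr_ge0// ?subr_ge0// /delta.
have := sum_delta (fun=> 1) x; under eq_bigr do rewrite mulr1.
rewrite /lazy_step big_split/= -mulr_sumr => ->.
by rewrite -[X in _ + X]mulr_sumr Q_sum; ring.
Qed.

Lemma iter_lazy_opE a f x N :
  iter N (lazy_op a) f x = \sum_(n < N.+1) 'C(N, n)%:R * (- a) ^+ n * iter n L f x.
Proof.
elim: N f x => [|N IH] f x; first by rewrite big_ord1/= bin0 !mul1r.
rewrite iterSr IH (binomial_shift (fun n => iter n L f x)) mulr_sumr -big_split/=.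
apply: eq_bigr => n _.
have -> : lazy_op a f = (fun y => f y + - a * L f y).
  by apply/funext => y; rewrite lazy_opE mulNr.
by rewrite iter_laplacianD -iterSr iterS; ring.
Qed.

(* Euler's formula: the binomial coefficients of [(1 - t L / N)^N] are within
   a factor [1 - n^2 / N] of those of the exponential series. *)
Lemma euler_heat_semigroup t f x : 0 <= t ->
  iter N.+1 (lazy_op (t / N.+1%:R)) f x @[N --> \oo] --> heat_semigroup mu t f x.
Proof.
move=> t0; have [F F0 fF] := bounded_fin f.
(* The factor [n^2 / N.+1] is absorbed by [n^2 <= 4^n], which multiplies the argument [t * 2] of the
   dominating exponential by 4. *)
pose C := expR (4 * (t * 2)) * F.
have close N : `|iter N.+1 (lazy_op (t / N.+1%:R)) f x -
    series (heat_coeff t f x) N.+2| <= C * N.+1%:R^-1.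
  rewrite iter_lazy_opE /series/= big_mkord -sumrB.
  rewrite (le_trans (ler_norm_sum _ _ _))//.
  apply: (@le_trans _ _ (\sum_(n < N.+2)
      (4 * (t * 2)) ^+ n / n`!%:R * F * N.+1%:R^-1)).
    apply: ler_sum => n _.
    have [lo hi] := @ffact_ratio R N.+1 n isT.
    set w := _ / _ ^+ _ in lo hi.
    have -> : 'C(N.+1, n)%:R * (- (t / N.+1%:R)) ^+ n * iter n L f x =
        w * heat_coeff t f x n.
      rewrite /w /heat_coeff -bin_ffact natrM -mulNr expr_div_n; field.
      by rewrite pnatr_eq0 -lt0n fact_gt0 expf_neq0// pnatr_eq0.
    rewrite -{2}[heat_coeff _ _ _ _]mul1r -mulrBl normrM distrC.
    rewrite [`|1 - w|]ger0_norm ?subr_ge0//.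
    have -> : (4 * (t * 2)) ^+ n / n`!%:R * F * N.+1%:R^-1 =
      (4 ^+ n / N.+1%:R) * ((`|t| * 2) ^+ n / n`!%:R * F).
      by rewrite ger0_norm// exprMn; ring.
    apply: ler_pM; rewrite ?subr_ge0//; last exact: norm_heat_coeff_le.
    apply: (@le_trans _ _ ((n ^ 2)%:R / N.+1%:R)).
      by rewrite lerBlDl -lerBlDr.
    rewrite ler_wpM2r ?invr_ge0// -natrX ler_nat.
    rewrite -[4%N]/(2 ^ 2)%N -expnM mulnC expnM leq_exp2r//.
    exact: ltnW (ltn_expl _ _).
  rewrite -!mulr_suml /C ler_wpM2r ?invr_ge0// ler_wpM2r//.
  rewrite -(big_mkord xpredT (fun n => (4 * (t * 2)) ^+ n / n`!%:R)).
  by apply: series_exp_coeff_le; rewrite !mulr_ge0.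
have cvg_diff : iter N.+1 (lazy_op (t / N.+1%:R)) f x -
    series (heat_coeff t f x) N.+2 @[N --> \oo] --> 0.
  apply/norm_cvg0P; apply: (@squeeze_cvgr _ _ _ _ (fun=> 0) (C \*o harmonic)).
  - by near=> N; rewrite normr_ge0/= close.
  - exact: cvg_cst.
  - rewrite -(mulr0 C); apply: cvgM; first exact: cvg_cst.
    exact: cvg_harmonic.
rewrite -[heat_semigroup _ _ _ _]add0r.
have cvg_ser : series (heat_coeff t f x) N.+2 @[N --> \oo] -->
    heat_semigroup mu t f x.
  have := cvg_heat_semigroup (t:=t) (f:=f) (x:=x).
  by rewrite -(cvg_shiftn 2); under eq_fun do rewrite addn2.
under eq_fun => N do
  rewrite -[iter _ _ _ _](subrK (series (heat_coeff t f x) N.+2)).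
exact: cvgD.
Unshelve. all: by end_near. Qed.

(** [lazy_op] is self-adjoint for the weights [m], so all [n] steps move from [f] to the point mass
    at [x]. *)
Lemma iter_lazy_op_sym a f x n :
  m x * iter n (lazy_op a) f x =
  \sum_y m y * iter n (lazy_op a) (delta R x) y * f y.
Proof.
have lazy_sym f1 f2 :
    \sum_y m y * lazy_op a f1 y * f2 y = \sum_y m y * f1 y * lazy_op a f2 y.
  rewrite /lazy_op.
  under eq_bigr do rewrite mulr_sumr mulr_suml.
  rewrite exchange_big/=; apply: eq_bigr => y _.
  rewrite mulr_sumr; apply: eq_bigr => z _.
  rewrite /lazy_step /delta eq_sym; case: eqVneq => [->|_]; first by ring.
  rewrite mulr0 !add0r.
  transitivity (m z * Q z y * (a * f1 y * f2 z)); first by ring.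
  by rewrite (mean_kernelP_reversible mu_sc mu_ge0 mu_vw); ring.
elim: n f => [|n IH] f.
  by rewrite -(sum_delta (fun y => m y * f y)); apply: eq_bigr => y _ /=; ring.
by rewrite iterSr IH -lazy_sym; apply: eq_bigr => y _; rewrite -iterS.
Qed.

(** Both sides, multiplied by [m x], are limits of the same Euler approximations, rewritten by
    [iter_lazy_op_sym]. *)
Lemma heat_kernelE t f x : 0 <= t ->
  heat_semigroup mu t f x = \sum_y heat_kernel mu t x y * f y.
Proof.
move=> t0; have mx : m x != 0 by rewrite gt_eqF// perron_gt0.
apply: (mulfI mx); rewrite mulr_sumr.
pose u N := m x * iter N.+1 (lazy_op (t / N.+1%:R)) f x.
have lhs : u N @[N --> \oo] --> m x * heat_semigroup mu t f x.
  by apply: cvgM; [exact: cvg_cst|exact: euler_heat_semigroup].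
have rhs : u N @[N --> \oo] --> \sum_y m x * (heat_kernel mu t x y * f y).
  rewrite /u; under eq_fun do rewrite iter_lazy_op_sym.
  apply: cvg_big => [|y _]; first exact: add_continuous.
  rewrite (_ : m x * _ = m y * heat_semigroup mu t (delta R x) y * f y).
    apply: cvgM; last exact: cvg_cst.
    by apply: cvgM; [exact: cvg_cst|exact: euler_heat_semigroup].
  by rewrite /heat_kernel; field.
exact: (cvg_unique (@Rhausdorff R) lhs rhs).
Qed.

Lemma lazy_op_cst a b : lazy_op a (fun=> b) = fun=> b.
Proof.
apply/funext => x; rewrite lazy_opE /chung_laplacian -mulr_suml Q_sum.
by rewrite mul1r subrr mulr0 subr0.
Qed.

Lemma heat_semigroup_cst t b x : 0 <= t -> heat_semigroup mu t (fun=> b) x = b.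
Proof.
move=> t0; have := euler_heat_semigroup (f:=fun=> b) (x:=x) t0.
have iter_cst a n : iter n (lazy_op a) (fun=> b) = fun=> b.
  by elim: n => //= n ->; rewrite lazy_op_cst.
under eq_fun do rewrite iter_cst.
move=> cvgb; exact: (cvg_unique (@Rhausdorff R) cvgb (cvg_cst b)).
Qed.

(** Once [N >= t], the Euler steps average against probability measures, so they preserve
    nonnegativity. *)
Lemma heat_semigroup_ge0 t f x : 0 <= t -> (forall y, 0 <= f y) ->
  0 <= heat_semigroup mu t f x.
Proof.
move=> t0 f0; apply: (cvgr_to_ge (euler_heat_semigroup (f:=f) (x:=x) t0)).
near=> N.
have tN : 0 <= t / N.+1%:R <= 1.
  rewrite divr_ge0//= ler_pdivrMr// mul1r (@le_trans _ _ N%:R) ?ler_nat//.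
  near: N; exact: nbhs_infty_ger.
have iter_ge0 n y : 0 <= iter n (lazy_op (t / N.+1%:R)) f y.
  elim: n y => //= n IH y; apply: sumr_ge0 => z _.
  by rewrite mulr_ge0// (lazy_step_prob _ tN).1.
exact: iter_ge0.
Unshelve. all: by end_near. Qed.

Lemma heat_kernel_prob t x : 0 <= t -> prob_mass (heat_kernel mu t x).
Proof.
move=> t0; split=> [y|].
  rewrite mulr_ge0// ?divr_ge0 ?(ltW (perron_gt0 _ _ _ _))//.
  by apply: heat_semigroup_ge0 => // z; rewrite /delta.
rewrite -[RHS](heat_semigroup_cst 1 x t0) heat_kernelE//.
by apply: eq_bigr => y _; rewrite mulr1.
Qed.

End Heat.

(** * Curvature *)

Section Curvature.
Variables (R : realType) (V : finType) (mu : V -> V -> R).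
Hypotheses (mu_sc : strongly_connected mu) (mu_ge0 : nonneg_weight mu).
Hypothesis mu_vw : forall x : V, 0 < vweight mu x.
Implicit Types (f : V -> R) (x y : V) (t e K : R).

Local Notation L := (chung_laplacian mu).
Local Notation d := (fun x y => (gdist mu x y)%:R : R).
Local Notation W e x y := (wasserstein mu (lazy_step mu e x) (lazy_step mu e y)).

Let d_gt0 x y : x != y -> 0 < d x y.
Proof. by move=> xy; rewrite ltr0n gdist_gt0. Qed.

Let lazy_prob e x : 0 <= e <= 1 -> prob_mass (lazy_step mu e x).
Proof. exact: lazy_step_prob. Qed.

Lemma lazy_op_le_wasserstein e (c : R) f x y : 0 <= e <= 1 -> 0 <= c ->
  (forall u v, f v - f u <= c * d u v) ->
  lazy_op mu e f y - lazy_op mu e f x <= c * W e x y.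
Proof. by move=> e01 c0 fc; apply: sub_le_wasserstein => //; exact: lazy_prob. Qed.

(** [lazy_step] is affine in its parameter: the step [a] mixes the point mass, of weight
    [1 - a / b], with the step [b]. *)
Lemma wasserstein_lazy_convex a b x y : 0 < a -> a <= b -> b <= 1 ->
  W a x y <= (1 - a / b) * d x y + a / b * W b x y.
Proof.
move=> a0 ab b1; have b0 : 0 < b by exact: lt_le_trans ab.
have b01 : 0 <= b <= 1 by rewrite ltW.
have a01 : 0 <= a <= 1 by rewrite ltW//= (le_trans ab).
have s1 : a / b <= 1 by rewrite ler_pdivrMr// mul1r.
have s0 : 0 <= a / b by rewrite divr_ge0// ltW.
apply: wasserstein_le => //; try exact: lazy_prob.
move=> f f1; rewrite -/(lazy_op mu a f y) -/(lazy_op mu a f x).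
have f1' u v : f v - f u <= 1 * d u v by rewrite mul1r.
have := lazy_op_le_wasserstein x y b01 ler01 f1'; rewrite mul1r => fW.
have -> : lazy_op mu a f y - lazy_op mu a f x = (1 - a / b) * (f y - f x) +
    a / b * (lazy_op mu b f y - lazy_op mu b f x).
  by rewrite !lazy_opE//; field; rewrite gt_eqF.
by rewrite lerD// ler_wpM2l// subr_ge0.
Qed.

Lemma curv_eps_nonincreasing x y : x != y ->
  {in `]0, 1] &, nonincreasing_fun (fun e => curv_eps mu e x y / e)}.
Proof.
move=> xy a b; rewrite !in_itv/= => /andP[a0 _] /andP[b0 b1] ab.
have d0 := d_gt0 xy.
have ww' := wasserstein_lazy_convex x y a0 ab b1.
rewrite /curv_eps ler_pdivlMr// -(ler_pM2r d0) [leRHS]mulrBl mul1r.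
rewrite [leRHS](_ : _ = d x y - W a x y); last by rewrite divfK// gt_eqF.
move: ww'; set w := W b x y; set w' := W a x y => ww'.
have -> : (1 - w / d x y) / b * a * d x y = a / b * d x y - a / b * w.
  by field; rewrite !gt_eqF.
by lra.
Qed.

(** The distance from [x] is a 1-Lipschitz test function; it bounds the transport cost below and so
    the quotient above, uniformly in [e]. *)
Lemma curv_eps_le e x y : x != y -> 0 < e <= 1 ->
  curv_eps mu e x y / e <= (L (d x) y - L (d x) x) / d x y.
Proof.
move=> xy /andP[e0 e1]; have d0 := d_gt0 xy.
have e01 : 0 <= e <= 1 by rewrite ltW.
have d1 u v : d x v - d x u <= 1 * d u v.
  by rewrite mul1r lerBlDl -natrD ler_nat gdist_triangle.
have := lazy_op_le_wasserstein x y e01 ler01 d1.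
rewrite !lazy_opE// gdistxx// mul1r; set w := W e x y => dW.
rewrite /curv_eps ler_pdivrMr// -(ler_pM2r d0) mulrBl mul1r divfK ?gt_eqF//.
by rewrite mulrAC divfK ?gt_eqF//; lra.
Qed.

(** A monotone bounded quotient converges, so the [lim] in [curv] is not a default value. *)
Lemma cvg_curv x y : x != y ->
  curv_eps mu e x y / e @[e --> 0^'+] --> curv mu x y.
Proof.
move=> xy; have cv := nonincreasing_at_right_cvgr _ (curv_eps_nonincreasing xy) _.
rewrite /curv; apply: cvgP; apply: cv; first by rewrite bnd_simp.
exists ((L (d x) y - L (d x) x) / d x y) => _ [e + <-].
by rewrite /= in_itv/=; exact: curv_eps_le.
Qed.

(** By duality each step multiplies the Lipschitz bound by at most [W / d <= 1 - e k]; the sign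
    condition keeps that bound nonnegative. *)
Lemma iter_lazy_op_contract e k f n x y : 0 < e <= 1 -> 0 <= 1 - e * k ->
  (forall u v, u != v -> k <= curv_eps mu e u v / e) ->
  iter n (lazy_op mu e) f y - iter n (lazy_op mu e) f x
    <= Lip mu f * (1 - e * k) ^+ n * d x y.
Proof.
move=> /andP[e0 e1] ek0 kc; have e01 : 0 <= e <= 1 by rewrite ltW.
elim: n x y => [|n IH] x y; first by rewrite mulr1; exact: sub_le_Lip.
have [->|xy] := eqVneq x y; first by rewrite subrr gdistxx// mulr0.
have c0 : 0 <= Lip mu f * (1 - e * k) ^+ n.
  by rewrite mulr_ge0 ?Lip_ge0// exprn_ge0.
have := lazy_op_le_wasserstein x y e01 c0 IH; move/le_trans; apply.
rewrite exprSr mulrA -[leRHS]mulrA ler_wpM2l//.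
have := kc _ _ xy; rewrite /curv_eps ler_pdivlMr// lerBrDr -lerBrDl.
by rewrite ler_pdivrMr ?d_gt0// [k * e]mulrC.
Qed.

Lemma curv_ge_gradient_bound K f t x y : 0 < t ->
  (forall u v, u != v -> K <= curv mu u v) ->
  heat_semigroup mu t f y - heat_semigroup mu t f x
    <= expR (- K * t) * Lip mu f * d x y.
Proof.
move=> t0 curvK; have t0' := ltW t0.
(* Strictness makes the lower bound [k] valid for small positive [e]; [K] itself is reached below
   through [K - N.+1%:R^-1]. *)
have bound k : k < K ->
    heat_semigroup mu t f y - heat_semigroup mu t f x
      <= Lip mu f * d x y * expR (- k * t).
  move=> kK.
  pose good e := [/\ 0 < e <= 1, 0 <= 1 - e * k &
    forall z : V * V, z.1 != z.2 -> k <= curv_eps mu e z.1 z.2 / e].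
  have nearg : \forall e \near 0^'+, good e.
    have near_curv : \forall e \near 0^'+, forall z : V * V, z.1 != z.2 ->
        k <= curv_eps mu e z.1 z.2 / e.
      (* There are finitely many pairs, so one neighbourhood of 0 serves them all. *)
      apply: filter_forall => z; have [_|zz] := eqVneq z.1 z.2.
        by near=> e.
      near=> e => _; apply: ltW; near: e.
      exact: (@cvgr_gt _ _ _ _ _ _ (cvg_curv zz) _ (lt_le_trans kK (curvK _ _ zz))).
    near=> e; split; [| |by near: e].
      by apply/andP; split; near: e; [exact: nbhs_right_gt|exact: nbhs_right_le].
    have k1 : 0 < `|k| + 1 by rewrite ltr_wpDl.
    have e0 : 0 < e by near: e; exact: nbhs_right_gt.
    (* Adding 1 keeps the threshold meaningful when [k = 0]. *)
    have ek : e * (`|k| + 1) <= 1.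
      rewrite -ler_pdivlMr// mul1r; near: e; apply: nbhs_right_le.
      by rewrite invr_gt0.
    rewrite subr_ge0 (le_trans _ ek)// ler_pM2l//.
    by rewrite (le_trans (ler_norm _))// lerDl.
  pose u N := iter N.+1 (lazy_op mu (t / N.+1%:R)) f y -
              iter N.+1 (lazy_op mu (t / N.+1%:R)) f x.
  have ucvg : u N @[N --> \oo] -->
      heat_semigroup mu t f y - heat_semigroup mu t f x.
    by apply: cvgB; exact: euler_heat_semigroup.
  apply: (cvgr_to_le ucvg); have := near_right0_shrink t0 nearg.
  apply: filterS => N [e01 ek0 kc].
  have := @iter_lazy_op_contract _ k f N.+1 x y e01 ek0 (fun u v => kc (u, v)).
  move/le_trans; apply; rewrite mulrAC ler_wpM2l//.
    by rewrite mulr_ge0 ?Lip_ge0.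
  have -> : - k * t = (- (t / N.+1%:R * k)) * N.+1%:R.
    by rewrite !mulNr [_ * _%:R]mulrAC divfK ?pnatr_eq0// mulrC.
  rewrite expRM_natr lerXn2r ?nnegrE ?expR_ge0//.
  exact: expR_ge1Dx.
have lim : Lip mu f * d x y * expR (- (K - N.+1%:R^-1) * t) @[N --> \oo] -->
    Lip mu f * d x y * expR (- (K - 0) * t).
  apply: cvgM; first exact: cvg_cst.
  apply: continuous_cvg; first exact: continuous_expR.
  apply: cvgM; last exact: cvg_cst.
  by apply: cvgN; apply: cvgB; [exact: cvg_cst|exact: cvg_harmonic].
rewrite subr0 in lim; rewrite -mulrA mulrC.
apply: (cvgr_to_ge lim); near=> N; apply: bound.
by rewrite ltrBlDr ltrDl invr_gt0.
Unshelve. all: by end_near. Qed.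

(** Integrating a 1-Lipschitz test function against the kernels evaluates the semigroup on it, where
    the gradient bound applies. *)
Lemma heat_wasserstein_le K t x y : 0 < t ->
  (forall f, Lip mu (heat_semigroup mu t f) <= expR (- K * t) * Lip mu f) ->
  wasserstein mu (heat_kernel mu t x) (heat_kernel mu t y)
    <= expR (- K * t) * d x y.
Proof.
move=> t0 lip; have t0' := ltW t0.
apply: wasserstein_le => //; try exact: heat_kernel_prob.
move=> f f1; rewrite -!heat_kernelE//.
apply: le_trans (sub_le_Lip mu_sc _ _ _) _; rewrite ler_wpM2r//.
apply: le_trans (lip f) _; rewrite ler_piMr ?expR_ge0//.
by apply: Lip_le => // u v _; rewrite mul1r.
Qed.

Lemma curv_ge_of_wasserstein K x y : x != y ->
  (forall t, 0 < t -> wasserstein mu (heat_kernel mu t x) (heat_kernel mu t y)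
     <= expR (- K * t) * d x y) ->
  K <= curv mu x y.
Proof.
move=> xy WK; have d0 := d_gt0 xy.
(* [D] is a crude bound on the diameter; [A] counts the second-order error once at [x] and once at
   [y]. *)
pose D : R := \sum_u \sum_v d u v; pose A := 2 * (expR 2 * D).
have dD u v : d u v <= D.
  rewrite /D (bigD1 u)//= (bigD1 v)//= -addrA lerDl.
  by rewrite addr_ge0// sumr_ge0// => *; rewrite sumr_ge0.
have lazyW t : 0 < t <= 1 -> W t x y <= expR (- K * t) * d x y + t ^+ 2 * A.
  move=> /andP[t0 t1]; have t0' := ltW t0; have t01 : 0 <= t <= 1 by rewrite t0'.
  apply: wasserstein_le => //; try exact: lazy_prob.
  move=> f f1; rewrite -/(lazy_op mu t f y) -/(lazy_op mu t f x).
  (* Normalizing [f x = 0] bounds [f] by the diameter. *)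
  pose g z := f z + -1 * f x.
  have gD z : `|g z| <= D.
    rewrite ler_norml /g; have := f1 x z; have := f1 z x.
    by have := dD x z; have := dD z x; lra.
  have Lg z : L g z = L f z.
    have /= -> := iter_laplacianD mu f (fun=> f x) (-1) 1 z.
    rewrite /chung_laplacian -mulr_suml sum_mean_kernelP//.
    by rewrite mul1r subrr mulr0 addr0.
  have g1 u v : g v - g u <= 1 * d u v.
    by rewrite mul1r /g; have := f1 u v; lra.
  have gW : heat_semigroup mu t g y - heat_semigroup mu t g x
      <= expR (- K * t) * d x y.
    rewrite !heat_kernelE//; apply: le_trans (WK t t0).
    rewrite -[leRHS]mul1r; apply: sub_le_wasserstein => //;
      exact: heat_kernel_prob.
  have := heat_semigroup_order2 mu_sc mu_ge0 mu_vw x gD t01.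
  have := heat_semigroup_order2 mu_sc mu_ge0 mu_vw y gD t01.
  rewrite !ler_norml !Lg !lazy_opE// /A /g; rewrite /g in gW.
  move=> /andP[hy _] /andP[_ hx]; move: hx hy gW; rewrite [_ * (2 * _)]mulrCA.
  set E := expR _ * _; set B := t ^+ 2 * _.
  lra.
(* [2 * K ^+ 2] comes from the quadratic bound on the exponential. The error [A] is absorbed because
   [d x y >= 1]. *)
pose C := 2 * K ^+ 2 + A.
have curvt t : 0 < t <= 1 -> `|K| * t <= 2^-1 -> K - C * t <= curv_eps mu t x y / t.
  move=> t01 Kt; have /andP[t0 t1] := t01.
  rewrite /curv_eps ler_pdivlMr// lerBrDr -lerBrDl.
  rewrite ler_pdivrMr//; apply: le_trans (lazyW t t01) _.
  have Kt2 : - 2^-1 <= K * t.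
    by move: Kt; rewrite -{1}(ger0_norm (ltW t0)) -normrM ler_norml => /andP[].
  have expK : expR (- K * t) <= 1 - K * t + 2 * (K * t) ^+ 2.
    by rewrite mulNr expRN_le_quadratic.
  have d1 : 1 <= d x y by rewrite ler1n gdist_gt0.
  have D0 : 0 <= D by apply: le_trans (dD x x).
  have A0 : 0 <= A by rewrite /A !mulr_ge0// expR_ge0.
  have : expR (- K * t) * d x y <= (1 - K * t + 2 * (K * t) ^+ 2) * d x y.
    by rewrite ler_wpM2r.
  have : t ^+ 2 * A <= t ^+ 2 * A * d x y.
    by rewrite ler_peMr// mulr_ge0// exprn_ge0// (ltW t0).
  rewrite /C; set T := t ^+ 2 * A * _; set S := t ^+ 2 * A.
  have -> : (1 - (K - (2 * K ^+ 2 + A) * t) * t) * d x y =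
     (1 - K * t + 2 * (K * t) ^+ 2) * d x y + T by rewrite /T; ring.
  by lra.
have lim : curv_eps mu e x y / e + C * e @[e --> 0^'+] --> curv mu x y + C * 0.
  apply: cvgD; first exact: cvg_curv.
  apply: cvgM; first exact: cvg_cst.
  by apply: cvg_at_right_filter; exact: cvg_id.
rewrite mulr0 addr0 in lim; apply: (cvgr_to_ge lim); near=> e.
have e0 : 0 < e by near: e; exact: nbhs_right_gt.
rewrite -lerBlDr; apply: curvt.
  by rewrite e0; near: e; exact: nbhs_right_le.
(* Taking [e] below the inverse of this number ensures the condition on [K] and [e] required by
   [curvt]. *)
have K1 : 0 < 2 * (`|K| + 1) by rewrite mulr_gt0// ltr_wpDl.
have : e * (2 * (`|K| + 1)) <= 1.
  rewrite -ler_pdivlMr// mul1r; near: e; apply: nbhs_right_le.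
  by rewrite invr_gt0.
by lra.
Unshelve. all: by end_near. Qed.

End Curvature.

Theorem theorem1p1 (R : realType) (V : finType) (mu : V -> V -> R)
    (mu_ge0 : nonneg_weight mu)
    (mu_simple : simple_graph mu)
    (mu_sc : strongly_connected mu)
    (mu_vw : forall x : V, 0 < vweight mu x)
    (K : R) :
  [<-> (K%:E <= ereal_inf [set k | exists x y : V,
                             x != y /\ k = (curv mu x y)%:E])%E;
       forall (f : V -> R) (t : R), 0 < t ->
         Lip mu (heat_semigroup mu t f) <= expR (- K * t) * Lip mu f;
       forall (x y : V) (t : R), 0 < t ->
         wasserstein mu (heat_kernel mu t x) (heat_kernel mu t y)
           <= expR (- K * t) * (gdist mu x y)%:R].
Proof.
tfae.
- move=> infK f t t0.
  have curvK x y : x != y -> K <= curv mu x y.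
    move=> xy; rewrite -lee_fin; apply: le_trans infK _.
    by apply: ereal_inf_lbound; exists x, y.
  apply: Lip_le => // [|x y _].
    by rewrite mulr_ge0 ?expR_ge0// Lip_ge0.
  exact: curv_ge_gradient_bound.
- move=> lip x y t t0; apply: heat_wasserstein_le => // f; exact: lip.
- move=> WK; apply: le_ereal_inf_tmp => _ [x [y [xy ->]]].
  by rewrite lee_fin; apply: curv_ge_of_wasserstein => // t; exact: WK.
Qed.
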